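(* Let $\nu\in\mathbb{R}$ and let $a>0$ be real. For any complex $z$ with $\operatorname{Re}(z)>\max\{0,2(\nu+1)\}$, setting $\mu(z)=\sqrt{2z+\nu^2}$, we have $$D_\nu(a,z)=\frac{\Gamma\Big(\frac{\nu+4+\mu(z)}{2}\Big)}{\Gamma(\mu(z)+1)}\cdot\Phi\Big(\frac{\nu+4+\mu(z)}{2},\,\mu(z)+1;\,\frac{1}{2a}\Big)\cdot\frac{(2a)^{\frac{\nu+2-\mu(z)}{2}}}{e^{\frac{1}{2a}}}.$$
   Context: The function $D_\nu(a,z)$ is defined by $$D_\nu(a,z)=\frac{e^{-\frac{1}{2a}}}{a}\int_0^\infty e^{-\frac{x^2}{2a}}\,x^{\nu+3}\,I_{\sqrt{2z+\nu^2}}\Big(\frac{x}{a}\Big)\,dx ,$$ where all square roots are defined by the principal branch of the logarithm and $I_\mu$ is the modified Bessel function of the first kind of complex order $\mu$: $I_\mu(\xi)=\sum_{n\ge0}\frac{(\xi/2)^{\mu+2n}}{n!\,\Gamma(\mu+1+n)}$ for $\xi>0$. $\Phi$ is Kummer's confluent hypergeometric function: $\Phi(\alpha,\gamma;x)=\sum_{n\ge0}\frac{(\alpha)_n}{(\gamma)_n}\frac{x^n}{n!}$, with $(\alpha)_n=\alpha(\alpha+1)\cdots(\alpha+n-1)$ and $(\alpha)_0=1$. *)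

(* Defs.v *)
From Stdlib Require Import Reals ZArith.
From Coquelicot Require Import Coquelicot.

Open Scope R_scope.

Definition Cexp (w : C) : C := (exp (Re w) * (cos (Im w), sin (Im w)))%C.

(* Principal argument, with values in (-PI, PI], of w <> 0. *)
Definition Carg (w : C) : R :=
  if Rle_dec 0 (Im w) then acos (Re w / Cmod w) else - acos (Re w / Cmod w).

Definition Clog (w : C) : C := (ln (Cmod w), Carg w).

Definition Csqrt (w : C) : C :=
  if Ceq_dec w 0 then RtoC 0 else Cexp (Clog w / 2)%C.

(* x ^ s for x > 0 and s complex. *)
Definition RCpower (x : R) (s : C) : C := Cexp (s * ln x)%C.

Definition CSeries (u : nat -> C) : C :=
  iota (T := C_CompleteNormedModule) (is_series (V := C_NormedModule) u).

(* Since real powers are meaningless at 0, the lower endpoint is taken as a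
   limit from the right. *)
Definition ex_CInt_0_infty (f : R -> C) : Prop :=
  ex_RInt_gen (V := C_R_NormedModule) f (at_right 0) (Rbar_locally p_infty).

Definition CInt_0_infty (f : R -> C) : C :=
  RInt_gen (V := C_R_CompleteNormedModule) f
    (at_right 0) (Rbar_locally p_infty).

Fixpoint poch (s : C) (n : nat) : C :=
  match n with
  | O => RtoC 1
  | S m => (poch s m * (s + INR m))%C
  end.

Definition EulerGamma (s : C) : C :=
  CInt_0_infty (fun t => (exp (- t) * RCpower t (s - 1))%C).

(* Euler's integral, continued analytically by
   Gamma s = Gamma (s + n) / (s (s + 1) ... (s + n - 1)),
   with n the least natural number such that Re s + n > 0 (n = 0 when
   Re s > 0).  At a pole, poch s n = 0 and hence Gamma s = / Gamma s = 0:
   the second equality is the usual value of 1 / Gamma. *)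
Definition CGamma (s : C) : C :=
  let n := Z.to_nat (up (- Re s)) in
  (EulerGamma (s + INR n) / poch s n)%C.

(* Modified Bessel function of the first kind of complex order, for xi > 0. *)
Definition BesselI (mu : C) (xi : R) : C :=
  CSeries (fun n =>
    (RCpower (xi / 2) (mu + 2 * INR n)
     / (INR (fact n) * CGamma (mu + 1 + INR n)))%C).

Definition KummerPhi (alpha gamma x : C) : C :=
  CSeries (fun n =>
    (poch alpha n / poch gamma n * (Cpow x n / INR (fact n)))%C).

Definition mu (nu : R) (z : C) : C := Csqrt (2 * z + nu ^ 2)%C.

Definition Dnu_integrand (nu a : R) (z : C) (x : R) : C :=
  (exp (- (x ^ 2 / (2 * a))) * Rpower x (nu + 3) * BesselI (mu nu z) (x / a))%C.

Definition Dnu (nu a : R) (z : C) : C :=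
  (exp (- (1 / (2 * a))) / a * CInt_0_infty (Dnu_integrand nu a z))%C.

(* Main.v *)
Require Import Defs.
From Stdlib Require Import Reals Factorial Lra Lia.
From Coquelicot Require Import Coquelicot.
Open Scope R_scope.

(** Expand the Bessel function into its series and integrate term by term.

    The hypothesis on [z] gives [Re mu > 0] and [Re mu > - (nu + 2)], because
    the principal root satisfies [(Re mu)^2 >= Re (mu^2) > (nu + 2)^2]
    ([Re_mu]).  Hence every Gamma function in sight has
    an argument of positive real part, where it is given by Euler's integral
    and satisfies [Gamma (s + n) = Gamma s * poch s n] ([CGamma_poch]).

    The n-th term is a constant times [exp (- x^2 / 2a) x^(2 (alpha + n) - 1)]
    with [alpha = (nu + 4 + mu) / 2], and the substitution [t = x^2 / 2a] turns
    its integral into [Gamma (alpha + n)] ([is_CInt_Gauss]).  Dividing out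
    [Gamma alpha / Gamma (mu + 1)] leaves exactly the n-th term of Kummer's
    series at [1 / 2a].

    The interchange of sum and integral ([CInt_0_infty_Cseries]) needs the n-th
    term to be at most [c n * g x] with [c] summable and [g] integrable.  Since
    [|poch (mu + 1) n| >= n!], the n-th term contains [(x^2 / 4a^2)^n] over
    [n! * n!].  With [t = x^2 / 4a] this is [(t^n / n!) * (1 / a)^n / n!]; the
    first factor is at most [exp t], which spends half of the Gaussian weight,
    and the second one is summable ([Gauss_pow_le_beta_prime]).

    Gamma enters Bessel's series through its reciprocal.  Since [/ 0 = 0], the
    reciprocal of a product is the product of the reciprocals ([Cinv_mult]), and
    the constant [Gamma alpha / Gamma (mu + 1)] is taken out of the series by
    [CSeries_factor], which covers a vanishing constant as well. *)

(** * Complex-valued functions of a real variable *)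

Lemma filterlim_C {T} (F : (T -> Prop) -> Prop) {FF : Filter F} (f : T -> C) (l : C) :
  filterlim f F (locally (T := C_UniformSpace) l) <->
  (forall eps, 0 < eps -> F (fun x => Cmod (f x - l) < eps)).
Proof.
  rewrite (filterlim_locally (U := C_UniformSpace)); split.
  - intros H eps He.
    assert (Hs : 0 < sqrt 2) by (apply sqrt_lt_R0; lra).
    assert (He' : 0 < eps / sqrt 2) by (apply Rdiv_lt_0_compat; lra).
    generalize (H (mkposreal _ He')). apply filter_imp; intros x Hx.
    apply C_NormedModule_mixin_compat2 in Hx; simpl in Hx.
    replace eps with (sqrt 2 * (eps / sqrt 2)) by (field; lra). exact Hx.
  - intros H eps. generalize (H eps (cond_pos eps)). apply filter_imp; intros x Hx.
    now apply C_NormedModule_mixin_compat1.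
Qed.

(** The norm of the product space R * R is the Euclidean one, so estimates for
    integrals in that space are estimates for the modulus. *)
Lemma norm_C_R (z : C) : norm (V := C_R_NormedModule) z = Cmod z.
Proof.
  unfold Cmod. rewrite <- (pow2_abs (fst z)), <- (pow2_abs (snd z)). reflexivity.
Qed.

Lemma continuous_C (f : R -> C) (x : R) :
  continuous (fun t => Re (f t)) x -> continuous (fun t => Im (f t)) x ->
  continuous (U := C_UniformSpace) f x.
Proof.
  intros H1 H2. apply (filterlim_locally (U := C_UniformSpace)); intros eps.
  generalize (filter_and _ _ (proj1 (filterlim_locally _ _) H1 eps)
                (proj1 (filterlim_locally _ _) H2 eps)).
  apply filter_imp; intros y [Ha Hb]. now split.
Qed.

Lemma continuous_Re (f : R -> C) (x : R) :
  continuous (U := C_UniformSpace) f x -> continuous (fun t => Re (f t)) x.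
Proof.
  intros H. apply filterlim_locally; intros eps.
  generalize (proj1 (filterlim_locally (U := C_UniformSpace) _ _) H eps).
  apply filter_imp; intros y [Ha Hb]. exact Ha.
Qed.

Lemma continuous_Im (f : R -> C) (x : R) :
  continuous (U := C_UniformSpace) f x -> continuous (fun t => Im (f t)) x.
Proof.
  intros H. apply filterlim_locally; intros eps.
  generalize (proj1 (filterlim_locally (U := C_UniformSpace) _ _) H eps).
  apply filter_imp; intros y [Ha Hb]. exact Hb.
Qed.

Lemma continuous_Cmult (f g : R -> C) (x : R) :
  continuous (U := C_UniformSpace) f x -> continuous (U := C_UniformSpace) g x ->
  continuous (U := C_UniformSpace) (fun t => (f t * g t)%C) x.
Proof.
  intros Hf Hg; apply continuous_C; simpl.
  - apply (continuous_minus (V := R_NormedModule));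
      apply (continuous_mult (K := R_AbsRing));
      auto using continuous_Re, continuous_Im.
  - apply (continuous_plus (V := R_NormedModule));
      apply (continuous_mult (K := R_AbsRing));
      auto using continuous_Re, continuous_Im.
Qed.

Lemma continuous_Cplus (f g : R -> C) (x : R) :
  continuous (U := C_UniformSpace) f x -> continuous (U := C_UniformSpace) g x ->
  continuous (U := C_UniformSpace) (fun t => (f t + g t)%C) x.
Proof. exact (continuous_plus (V := C_R_NormedModule) f g x). Qed.

Lemma is_RInt_C (f : R -> C) (a b : R) (l : C) :
  is_RInt (fun t => Re (f t)) a b (Re l) -> is_RInt (fun t => Im (f t)) a b (Im l) ->
  is_RInt (V := C_R_NormedModule) f a b l.
Proof.
  intros H1 H2. destruct l as [l1 l2].
  exact (is_RInt_fct_extend_pair (U := R_NormedModule) (V := R_NormedModule) f a b l1 l2 H1 H2).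
Qed.

Lemma is_RInt_Cmult (c : C) (f : R -> C) (a b : R) (l : C) :
  is_RInt (V := C_R_NormedModule) f a b l ->
  is_RInt (V := C_R_NormedModule) (fun t => (c * f t)%C) a b (c * l)%C.
Proof.
  intros H.
  pose proof (is_RInt_fct_extend_fst (U := R_NormedModule) (V := R_NormedModule) f a b l H) as H1.
  pose proof (is_RInt_fct_extend_snd (U := R_NormedModule) (V := R_NormedModule) f a b l H) as H2.
  apply is_RInt_C; simpl.
  - exact (is_RInt_minus _ _ _ _ _ _ (is_RInt_scal _ _ _ (fst c) _ H1)
             (is_RInt_scal _ _ _ (snd c) _ H2)).
  - exact (is_RInt_plus _ _ _ _ _ _ (is_RInt_scal _ _ _ (fst c) _ H2)
             (is_RInt_scal _ _ _ (snd c) _ H1)).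
Qed.

(** * Improper integrals over the positive half-line *)

Definition is_CInt_0_infty (f : R -> C) (l : C) : Prop :=
  is_RInt_gen (V := C_R_NormedModule) f (at_right 0) (Rbar_locally p_infty) l.

Definition ends_0_infty : (R * R -> Prop) -> Prop :=
  filter_prod (at_right 0) (Rbar_locally p_infty).

#[local] Instance ends_0_infty_proper : ProperFilter ends_0_infty.
Proof. apply filter_prod_proper; typeclasses eauto. Qed.

Lemma ends_0_infty_pos : ends_0_infty (fun ab => 0 < fst ab /\ 0 < snd ab).
Proof.
  apply Filter_prod with (fun x => 0 < x) (fun x => 0 < x).
  - exists (mkposreal 1 Rlt_0_1); intros y _ Hy; exact Hy.
  - exists 0; auto.
  - simpl; auto.
Qed.

Lemma ends_0_infty_lt : ends_0_infty (fun ab => 0 < fst ab < snd ab).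
Proof.
  apply Filter_prod with (fun x => 0 < x < 1) (fun x => 1 < x).
  - exists (mkposreal 1 Rlt_0_1); intros y Hy H0; split; [exact H0|].
    apply Rabs_def2 in Hy; unfold minus, plus, opp in Hy; simpl in Hy; lra.
  - exists 1; auto.
  - simpl; intros; lra.
Qed.

(** Turns the filter definition of the improper integral into an estimate in
    the modulus, the form in which it is proved and used below. *)
Lemma is_CInt_0_infty_eps (f : R -> C) (l : C) :
  is_CInt_0_infty f l <->
  (forall eps, 0 < eps -> ends_0_infty (fun ab =>
     exists z : C, is_RInt (V := C_R_NormedModule) f (fst ab) (snd ab) z /\ Cmod (z - l) < eps)).
Proof.
  unfold is_CInt_0_infty, is_RInt_gen.
  rewrite (filterlimi_locally (U := C_UniformSpace)); split.
  - intros H eps He.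
    assert (Hs : 0 < sqrt 2) by (apply sqrt_lt_R0; lra).
    assert (He' : 0 < eps / sqrt 2) by (apply Rdiv_lt_0_compat; lra).
    generalize (H (mkposreal _ He')). apply filter_imp; intros x [z [Hz Hx]].
    exists z; split; [exact Hz|].
    apply C_NormedModule_mixin_compat2 in Hx; simpl in Hx.
    replace eps with (sqrt 2 * (eps / sqrt 2)) by (field; lra). exact Hx.
  - intros H eps. generalize (H eps (cond_pos eps)).
    apply filter_imp; intros x [z [Hz Hx]]. exists z; split; [exact Hz|].
    now apply C_NormedModule_mixin_compat1.
Qed.

Lemma is_CInt_0_infty_unique (f : R -> C) (l : C) :
  is_CInt_0_infty f l -> CInt_0_infty f = l.
Proof.
  intros H. unfold CInt_0_infty.
  exact (is_RInt_gen_unique (V := C_R_CompleteNormedModule) f l H).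
Qed.

Lemma is_CInt_0_infty_ext (f g : R -> C) (l : C) :
  (forall x, 0 < x -> f x = g x) -> is_CInt_0_infty f l -> is_CInt_0_infty g l.
Proof.
  intros Hfg.
  refine (is_RInt_gen_ext (V := C_R_NormedModule) (Fa := at_right 0)
            (Fb := Rbar_locally p_infty) f g l _).
  generalize ends_0_infty_pos. apply filter_imp. intros [a b] [Ha Hb] x [Hx _].
  apply Hfg. simpl in *. apply Rle_lt_trans with (2 := Hx).
  apply Rmin_case; lra.
Qed.

Lemma is_CInt_0_infty_Cmult (c : C) (f : R -> C) (l : C) :
  is_CInt_0_infty f l -> is_CInt_0_infty (fun x => (c * f x)%C) (c * l)%C.
Proof.
  rewrite !is_CInt_0_infty_eps. intros H eps He.
  pose proof (Cmod_ge_0 c) as Hc.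
  assert (He' : 0 < eps / (Cmod c + 1)) by (apply Rdiv_lt_0_compat; lra).
  generalize (H _ He'). apply filter_imp; intros ab [z [Hz Hl]].
  exists (c * z)%C; split; [now apply is_RInt_Cmult|].
  replace (c * z - c * l)%C with (c * (z - l))%C by ring.
  rewrite Cmod_mult.
  apply Rle_lt_trans with (Cmod c * (eps / (Cmod c + 1))).
  - apply Rmult_le_compat_l; lra.
  - apply Rmult_lt_reg_r with (Cmod c + 1); [lra|]. field_simplify; lra.
Qed.

Lemma is_CInt_0_infty_plus (f g : R -> C) (lf lg : C) :
  is_CInt_0_infty f lf -> is_CInt_0_infty g lg ->
  is_CInt_0_infty (fun x => (f x + g x)%C) (lf + lg)%C.
Proof. exact (is_RInt_gen_plus (V := C_R_NormedModule) f g lf lg). Qed.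

Lemma Rmin_le_pos (a b x : R) : 0 < a -> 0 < b -> Rmin a b <= x -> 0 < x.
Proof. intros Ha Hb Hx. apply Rlt_le_trans with (2 := Hx). now apply Rmin_glb_lt. Qed.

Lemma ex_RInt_pos (f : R -> C) :
  (forall x, 0 < x -> continuous (U := C_UniformSpace) f x) ->
  forall a b, 0 < a -> 0 < b -> ex_RInt (V := C_R_NormedModule) f a b.
Proof.
  intros Hf a b Ha Hb.
  apply (ex_RInt_continuous (V := C_R_CompleteNormedModule)).
  intros z [Hz _]. apply Hf. now apply Rmin_le_pos with a b.
Qed.

Lemma ex_RInt_pos_R (f : R -> R) :
  (forall x, 0 < x -> continuous f x) ->
  forall a b, 0 < a -> 0 < b -> ex_RInt f a b.
Proof.
  intros Hf a b Ha Hb. apply (ex_RInt_continuous (V := R_CompleteNormedModule)).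
  intros z [Hz _]. apply Hf. now apply Rmin_le_pos with a b.
Qed.

Lemma Cmod_is_RInt_le (f : R -> C) (g : R -> R) (a b : R) (l : C) (m : R) :
  (forall x, 0 < x -> Cmod (f x) <= g x) -> 0 < a -> 0 < b ->
  is_RInt (V := C_R_NormedModule) f a b l -> is_RInt g a b m -> Cmod l <= Rabs m.
Proof.
  intros Hfg Ha Hb Hl Hm. rewrite <- norm_C_R.
  destruct (Rle_dec a b) as [Hab|Hab].
  - apply Rle_trans with m; [|apply Rle_abs].
    apply (norm_RInt_le (V := C_R_NormedModule) f g a b l m); auto.
    intros x [Hx _]. rewrite norm_C_R. apply Hfg; lra.
  - apply is_RInt_swap in Hl. apply is_RInt_swap in Hm.
    rewrite <- Rabs_Ropp, <- norm_opp.
    apply Rle_trans with (- m); [|apply Rle_abs].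
    apply (norm_RInt_le (V := C_R_NormedModule) f g b a (opp l) (- m)); auto; try lra.
    intros x [Hx _]. rewrite norm_C_R. apply Hfg; lra.
Qed.

(** Comparison test.  Two integrals of [f] between positive bounds differ by
    integrals of [f] over the two end pieces; these are dominated by the same
    pieces of the convergent integral of [g], so the Cauchy criterion carries
    over from [g] to [f]. *)
Lemma ex_CInt_0_infty_le (f : R -> C) (g : R -> R) (m : R) :
  (forall x, 0 < x -> continuous (U := C_UniformSpace) f x) ->
  (forall x, 0 < x -> continuous g x) ->
  (forall x, 0 < x -> Cmod (f x) <= g x) ->
  is_RInt_gen g (at_right 0) (Rbar_locally p_infty) m ->
  ex_CInt_0_infty f.
Proof.
  intros Cf Cg Hfg Hm.
  set (I := fun ab : R * R => RInt (V := C_R_CompleteNormedModule) f (fst ab) (snd ab)).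
  assert (HI : forall a b, 0 < a -> 0 < b ->
    is_RInt (V := C_R_NormedModule) f a b (RInt (V := C_R_CompleteNormedModule) f a b)).
  { intros a b Ha Hb. apply (RInt_correct (V := C_R_CompleteNormedModule)).
    now apply ex_RInt_pos. }
  assert (HJ : forall a b, 0 < a -> 0 < b -> is_RInt g a b (RInt g a b)).
  { intros a b Ha Hb. apply (RInt_correct (V := R_CompleteNormedModule)).
    now apply ex_RInt_pos_R. }
  assert (Hlim : exists y, filterlim I ends_0_infty (locally (T := C_UniformSpace) y)).
  { apply (filterlim_locally_cauchy (U := C_R_CompleteNormedModule)).
    intros eps.
    destruct (proj1 (filterlimi_locally _ _) Hm (pos_div_2 (pos_div_2 eps))) as [P Q HP HQ HPQ].
    exists (fun ab => (P (fst ab) /\ Q (snd ab)) /\ (0 < fst ab /\ 0 < snd ab)).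
    split.
    { apply filter_and; [|exact ends_0_infty_pos].
      apply Filter_prod with P Q; auto. }
    intros [a b] [a' b'] [[Pa Qb] [Ha Hb]] [[Pa' Qb'] [Ha' Hb']]; simpl in *.
    assert (HG : forall u v, P u -> 0 < u -> Q v -> 0 < v -> Rabs (RInt g u v - m) < eps / 4).
    { intros u v Hu Hu0 Hv Hv0. destruct (HPQ u v Hu Hv) as [z [Hz1 Hz2]]. simpl in Hz1, Hz2.
      rewrite (is_RInt_unique _ _ _ _ Hz1).
      unfold ball in Hz2; simpl in Hz2; unfold AbsRing_ball, abs, minus, plus, opp in Hz2;
      simpl in Hz2. replace (eps / 2 / 2) with (eps / 4) in Hz2 by field. exact Hz2. }
    apply C_NormedModule_mixin_compat1.
    change (Cmod (I (a', b') - I (a, b))%C < eps).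
    (* Only the two end pieces, near 0 and near infinity, survive. *)
    replace (I (a', b') - I (a, b))%C with
      (RInt (V := C_R_CompleteNormedModule) f a' a + RInt (V := C_R_CompleteNormedModule) f b b')%C.
    2:{ unfold I; simpl.
        pose proof (is_RInt_Chasles (V := C_R_NormedModule) _ _ _ _ _ _ (HI a' a Ha' Ha)
          (is_RInt_Chasles (V := C_R_NormedModule) _ _ _ _ _ _ (HI a b Ha Hb) (HI b b' Hb Hb'))) as E.
        apply (is_RInt_unique (V := C_R_CompleteNormedModule)) in E. rewrite E.
        unfold plus; simpl; unfold prod_plus; unfold plus; simpl.
        apply injective_projections; simpl; ring. }
    assert (E1 : Rabs (RInt g a' a) < eps / 2).
    { replace (RInt g a' a) with ((RInt g a' b - m) - (RInt g a b - m)).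
      - pose proof (HG a b Pa Ha Qb Hb). pose proof (HG a' b Pa' Ha' Qb Hb).
        pose proof (Rabs_triang (RInt g a' b - m) (- (RInt g a b - m))) as T.
        rewrite Rabs_Ropp in T. unfold Rminus at 1. lra.
      - rewrite (is_RInt_unique _ _ _ _ (is_RInt_Chasles _ _ _ _ _ _ (HJ a' a Ha' Ha) (HJ a b Ha Hb))).
        unfold plus; simpl; ring. }
    assert (E2 : Rabs (RInt g b b') < eps / 2).
    { replace (RInt g b b') with ((RInt g a b' - m) - (RInt g a b - m)).
      - pose proof (HG a b Pa Ha Qb Hb). pose proof (HG a b' Pa Ha Qb' Hb').
        pose proof (Rabs_triang (RInt g a b' - m) (- (RInt g a b - m))) as T.
        rewrite Rabs_Ropp in T. unfold Rminus at 1. lra.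
      - rewrite (is_RInt_unique _ _ _ _ (is_RInt_Chasles _ _ _ _ _ _ (HJ a b Ha Hb) (HJ b b' Hb Hb'))).
        unfold plus; simpl; ring. }
    pose proof (Cmod_triangle (RInt (V := C_R_CompleteNormedModule) f a' a)
                  (RInt (V := C_R_CompleteNormedModule) f b b')) as T.
    pose proof (Cmod_is_RInt_le f g _ _ _ _ Hfg Ha' Ha (HI a' a Ha' Ha) (HJ a' a Ha' Ha)).
    pose proof (Cmod_is_RInt_le f g _ _ _ _ Hfg Hb Hb' (HI b b' Hb Hb') (HJ b b' Hb Hb')).
    lra. }
  destruct Hlim as [y Hy]. exists y.
  apply (filterlimi_lim_ext_loc I); [|exact Hy].
  generalize ends_0_infty_pos. apply filter_imp. intros [a b] [Ha Hb]. now apply HI.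
Qed.

Lemma CInt_0_infty_correct (f : R -> C) :
  ex_CInt_0_infty f -> is_CInt_0_infty f (CInt_0_infty f).
Proof. exact (RInt_gen_correct (V := C_R_CompleteNormedModule) f). Qed.

Lemma Cmod_CInt_0_infty_le (f : R -> C) (g : R -> R) (l : C) (m : R) :
  (forall x, 0 < x -> Cmod (f x) <= g x) ->
  is_CInt_0_infty f l -> is_RInt_gen g (at_right 0) (Rbar_locally p_infty) m ->
  Cmod l <= m.
Proof.
  intros Hfg Hf Hg. rewrite <- norm_C_R.
  refine (RInt_gen_norm (V := C_R_CompleteNormedModule) f g l m _ _ Hf Hg).
  - generalize ends_0_infty_lt. apply filter_imp. intros; lra.
  - generalize ends_0_infty_lt. apply filter_imp. intros [a b] Hab x Hx; simpl in *.
    pose proof (norm_C_R (f x)) as E. unfold norm in *; simpl in *. rewrite E. apply Hfg; lra.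
Qed.

(** * Series of complex numbers and termwise integration *)

#[local] Notation is_Cseries := (is_series (V := C_NormedModule)).

Fixpoint Csum (u : nat -> C) (n : nat) : C :=
  match n with O => u O | S m => (Csum u m + u (S m))%C end.

Lemma sum_n_Csum (u : nat -> C) (n : nat) :
  sum_n (G := C_NormedModule) u n = Csum u n.
Proof.
  induction n as [|n IH].
  - now rewrite sum_O.
  - rewrite sum_Sn, IH. reflexivity.
Qed.

Lemma is_Cseries_eps (u : nat -> C) (l : C) :
  is_Cseries u l <->
  (forall eps, 0 < eps -> eventually (fun n => Cmod (Csum u n - l) < eps)).
Proof.
  unfold is_series. rewrite <- (filterlim_C eventually).
  split; apply filterlim_ext; intros n; now rewrite sum_n_Csum.
Qed.

Lemma is_Cseries_unique (u : nat -> C) (l1 l2 : C) :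
  is_Cseries u l1 -> is_Cseries u l2 -> l1 = l2.
Proof. exact (filterlim_locally_unique (V := C_NormedModule) (sum_n u) l1 l2). Qed.

Lemma CSeries_unique (u : nat -> C) (l : C) : is_Cseries u l -> CSeries u = l.
Proof.
  intros H. apply (iota_unique (V := C_CompleteNormedModule)).
  - intros y Hy. exact (is_Cseries_unique u y l Hy H).
  - exact H.
Qed.

Lemma ex_Cseries_le (u : nat -> C) (b : nat -> R) (B : R) :
  (forall n, Cmod (u n) <= b n) -> is_series b B -> is_Cseries u (CSeries u).
Proof.
  intros H HB.
  destruct (ex_series_le (V := C_CompleteNormedModule) u b H (ex_intro _ B HB)) as [l Hl].
  rewrite (CSeries_unique u l Hl). exact Hl.
Qed.

Lemma is_Cseries_scal (c : C) (u : nat -> C) (l : C) :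
  is_Cseries u l -> is_Cseries (fun n => (c * u n)%C) (c * l)%C.
Proof. exact (is_series_scal (V := C_NormedModule) c u l). Qed.

(** A constant can be taken out of a convergent series even when it vanishes,
    in which case [u] itself may diverge: then both sides are 0, whatever the
    value of [CSeries u]. *)
Lemma CSeries_factor (c : C) (u : nat -> C) (l : C) :
  is_Cseries (fun n => (c * u n)%C) l -> l = (c * CSeries u)%C.
Proof.
  intros H. destruct (Ceq_dec c 0) as [->|Hc].
  - rewrite Cmult_0_l. apply (is_Cseries_unique _ _ _ H).
    apply is_Cseries_eps. intros eps He. exists O. intros n _.
    replace (Csum (fun n => 0 * u n) n)%C with (RtoC 0).
    + replace (0 - 0)%C with (RtoC 0) by ring. now rewrite Cmod_0.
    + induction n as [|n IH]; simpl; [|rewrite <- IH]; ring.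
  - apply (is_Cseries_scal (/ c)) in H.
    rewrite (CSeries_unique u (/ c * l)%C).
    + field. exact Hc.
    + revert H. apply (is_series_ext (V := C_NormedModule)). intros n.
      change ((/ c * (c * u n))%C = u n). field. exact Hc.
Qed.

Lemma Csum_tail_le (u : nat -> C) (b : nat -> R) (n k : nat) :
  (forall n, Cmod (u n) <= b n) ->
  Cmod (Csum u (n + k) - Csum u n) <= sum_n b (n + k) - sum_n b n.
Proof.
  intros H. induction k as [|k IH].
  - rewrite Nat.add_0_r. replace (Csum u n - Csum u n)%C with (RtoC 0) by ring.
    rewrite Cmod_0. lra.
  - rewrite Nat.add_succ_r. rewrite sum_Sn. simpl Csum. unfold plus; simpl.
    replace (Csum u (n + k) + u (S (n + k)) - Csum u n)%C
      with ((Csum u (n + k) - Csum u n) + u (S (n + k)))%C by ring.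
    pose proof (Cmod_triangle (Csum u (n + k) - Csum u n) (u (S (n + k)))).
    specialize (H (S (n + k))). lra.
Qed.

(** The bound for finite blocks passes to the limit. *)
Lemma Cseries_tail_le (u : nat -> C) (b : nat -> R) (l : C) (B : R) (n : nat) :
  (forall n, Cmod (u n) <= b n) -> is_Cseries u l -> is_series b B ->
  Cmod (l - Csum u n) <= B - sum_n b n.
Proof.
  intros H Hu Hb. apply le_epsilon. intros eps He.
  destruct (proj1 (is_Cseries_eps u l) Hu (eps / 2) ltac:(lra)) as [N1 H1].
  assert (Hb' := proj1 (filterlim_locally _ _) Hb (mkposreal (eps / 2) ltac:(lra))).
  destruct Hb' as [N2 H2]; simpl in H2.
  set (k := (N1 + N2)%nat).
  specialize (H1 (n + k)%nat ltac:(unfold k; lia)).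
  specialize (H2 (n + k)%nat ltac:(unfold k; lia)).
  change (Rabs (sum_n b (n + k) - B) < eps / 2) in H2.
  apply Rabs_def2 in H2.
  pose proof (Csum_tail_le u b n k H).
  replace (l - Csum u n)%C with (- (Csum u (n + k) - l) + (Csum u (n + k) - Csum u n))%C by ring.
  eapply Rle_trans; [apply Cmod_triangle|]. rewrite Cmod_opp. lra.
Qed.

Lemma continuous_Csum (f : nat -> R -> C) (n : nat) (x : R) :
  (forall n, continuous (U := C_UniformSpace) (f n) x) ->
  continuous (U := C_UniformSpace) (fun t => Csum (fun n => f n t) n) x.
Proof.
  intros H. induction n as [|n IH]; simpl.
  - apply H.
  - now apply continuous_Cplus.
Qed.

Lemma series_tail_small (b : nat -> R) (B : R) :
  is_series b B -> forall eps, 0 < eps -> exists n, forall k, (n <= k)%nat -> Rabs (B - sum_n b k) < eps.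
Proof.
  intros Hb eps He.
  destruct (proj1 (filterlim_locally _ _) Hb (mkposreal eps He)) as [n Hn].
  exists n. intros k Hk. specialize (Hn k Hk).
  change (Rabs (sum_n b k - B) < eps) in Hn.
  rewrite Rabs_minus_sym. exact Hn.
Qed.

(** Weierstrass: the tails are at most the tail of [c] times [g], and [g] is
    locally bounded, so the convergence is locally uniform. *)
Lemma continuous_Cseries (f : nat -> R -> C) (F : R -> C) (g : R -> R)
    (c : nat -> R) (B : R) :
  (forall n x, 0 < x -> continuous (U := C_UniformSpace) (f n) x) ->
  (forall x, 0 < x -> continuous g x) ->
  (forall n x, 0 < x -> Cmod (f n x) <= c n * g x) ->
  is_series c B ->
  (forall x, 0 < x -> is_Cseries (fun n => f n x) (F x)) ->
  forall x, 0 < x -> continuous (U := C_UniformSpace) F x.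
Proof.
  intros Cf Cg Hfg Hc HF x Hx.
  assert (Hsum : forall n x, sum_n (fun k => c k * g x) n = sum_n c n * g x).
  { intros n y. exact (sum_n_mult_r (K := R_Ring) (g y) c n). }
  assert (Htail : forall n y, 0 < y ->
    Cmod (F y - Csum (fun k => f k y) n) <= (B - sum_n c n) * g y).
  { intros n y Hy.
    replace ((B - sum_n c n) * g y) with (B * g y - sum_n (fun k => c k * g y) n).
    - apply Cseries_tail_le; auto.
      now apply is_series_scal_r.
    - rewrite Hsum. ring. }
  apply filterlim_C; [typeclasses eauto|]. intros eps He.
  assert (Hg : locally x (fun y => 0 < y /\ Rabs (g y) < Rabs (g x) + 1)).
  { apply filter_and.
    - now apply open_gt.
    - generalize (proj1 (filterlim_locally _ _) (Cg x Hx) (mkposreal 1 Rlt_0_1)).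
      apply filter_imp. intros y Hy.
      change (Rabs (g y - g x) < 1) in Hy.
      pose proof (Rabs_triang_inv (g y) (g x)). unfold Rminus in *. lra. }
  pose proof (Rabs_pos (g x)) as Hgx.
  destruct (series_tail_small c B Hc (eps / 3 / (Rabs (g x) + 1))) as [n Hn].
  { repeat apply Rdiv_lt_0_compat; lra. }
  specialize (Hn n (Nat.le_refl n)).
  assert (Hsmall : forall y, 0 < y -> Rabs (g y) < Rabs (g x) + 1 ->
            Cmod (F y - Csum (fun k => f k y) n) < eps / 3).
  { intros y Hy Hgy. eapply Rle_lt_trans; [now apply Htail|].
    apply Rle_lt_trans with (Rabs (B - sum_n c n) * Rabs (g y)).
    { rewrite <- Rabs_mult. apply Rle_abs. }
    apply Rle_lt_trans with (Rabs (B - sum_n c n) * (Rabs (g x) + 1)).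
    { apply Rmult_le_compat_l; [apply Rabs_pos|lra]. }
    apply Rlt_le_trans with (eps / 3 / (Rabs (g x) + 1) * (Rabs (g x) + 1)).
    - apply Rmult_lt_compat_r; lra.
    - right; field; lra. }
  generalize (filter_and _ _ Hg
    (proj1 (filterlim_C _ _ _) (continuous_Csum f n x (fun k => Cf k x Hx)) (eps / 3) ltac:(lra))).
  apply filter_imp. intros y [[Hy Hgy] Hs].
  replace (F y - F x)%C with ((F y - Csum (fun k => f k y) n) +
    ((Csum (fun k => f k y) n - Csum (fun k => f k x) n) + - (F x - Csum (fun k => f k x) n)))%C
    by ring.
  pose proof (Hsmall y Hy Hgy). pose proof (Hsmall x Hx ltac:(lra)).
  eapply Rle_lt_trans; [apply Cmod_triangle|].
  pose proof (Cmod_triangle (Csum (fun k => f k y) n - Csum (fun k => f k x) n)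
     (- (F x - Csum (fun k => f k x) n))) as T.
  rewrite Cmod_opp in T. lra.
Qed.

Lemma is_CInt_0_infty_Csum (f : nat -> R -> C) (l : nat -> C) (n : nat) :
  (forall n, is_CInt_0_infty (f n) (l n)) ->
  is_CInt_0_infty (fun x => Csum (fun k => f k x) n) (Csum l n).
Proof.
  intros H. induction n as [|n IH]; simpl.
  - apply H.
  - now apply is_CInt_0_infty_plus.
Qed.

(** Termwise integration: the error after n terms is dominated by the tail of
    [c] times [g], hence its integral is at most that tail times the integral
    of [g]. *)
Lemma CInt_0_infty_Cseries (f : nat -> R -> C) (l : nat -> C) (F : R -> C) (g : R -> R)
    (c : nat -> R) (B m : R) :
  (forall n x, 0 < x -> continuous (U := C_UniformSpace) (f n) x) ->
  (forall x, 0 < x -> continuous g x) ->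
  (forall n x, 0 < x -> Cmod (f n x) <= c n * g x) ->
  is_series c B ->
  is_RInt_gen g (at_right 0) (Rbar_locally p_infty) m ->
  (forall x, 0 < x -> is_Cseries (fun n => f n x) (F x)) ->
  (forall n, is_CInt_0_infty (f n) (l n)) ->
  ex_CInt_0_infty F /\ is_Cseries l (CInt_0_infty F).
Proof.
  intros Cf Cg Hfg Hc Hg HF Hl.
  assert (Hscal : forall k, is_RInt_gen (fun x => k * g x) (at_right 0) (Rbar_locally p_infty) (k * m)).
  { intros k. exact (is_RInt_gen_scal (V := R_NormedModule) g k m Hg). }
  assert (Hseries : forall x, is_series (fun n => c n * g x) (B * g x)).
  { intros x. now apply is_series_scal_r. }
  assert (Hsum : forall n x, sum_n (fun k => c k * g x) n = sum_n c n * g x).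
  { intros n x. exact (sum_n_mult_r (K := R_Ring) (g x) c n). }
  assert (EF : ex_CInt_0_infty F).
  { apply ex_CInt_0_infty_le with (fun x => B * g x) (B * m); auto.
    - now apply continuous_Cseries with f g c B.
    - intros x Hx. apply (continuous_mult (K := R_AbsRing)); [apply continuous_const|auto].
    - intros x Hx.
      pose proof (Cseries_tail_le _ _ _ _ 0 (fun n => Hfg n x Hx) (HF x Hx) (Hseries x)) as T.
      rewrite Hsum, sum_O in T. simpl in T.
      pose proof (Hfg O x Hx).
      pose proof (Cmod_triangle (F x - f O x) (f O x)) as T'.
      replace (F x - f O x + f O x)%C with (F x) in T' by ring. lra. }
  split; [exact EF|].
  pose proof (CInt_0_infty_correct F EF) as HFint.
  apply is_Cseries_eps. intros eps He.
  destruct (series_tail_small c B Hc (eps / (Rabs m + 1))) as [N HN].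
  { pose proof (Rabs_pos m). apply Rdiv_lt_0_compat; lra. }
  exists N. intros n Hn. specialize (HN n Hn).
  assert (Hd : Cmod (CInt_0_infty F - Csum l n) <= (B - sum_n c n) * m).
  { apply (Cmod_CInt_0_infty_le (fun x => F x - Csum (fun k => f k x) n)%C
             (fun x => (B - sum_n c n) * g x)); [| |apply Hscal].
    - intros x Hx. replace ((B - sum_n c n) * g x) with (B * g x - sum_n (fun k => c k * g x) n).
      + apply Cseries_tail_le; auto.
      + rewrite Hsum. ring.
    - apply is_CInt_0_infty_ext with (fun x => F x + (- 1) * Csum (fun k => f k x) n)%C.
      { intros; ring. }
      replace (CInt_0_infty F - Csum l n)%C with (CInt_0_infty F + (- 1) * Csum l n)%C by ring.
      apply is_CInt_0_infty_plus; [exact HFint|].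
      apply is_CInt_0_infty_Cmult. now apply is_CInt_0_infty_Csum. }
  replace (Csum l n - CInt_0_infty F)%C with (- (CInt_0_infty F - Csum l n))%C by ring.
  rewrite Cmod_opp. apply Rle_lt_trans with (1 := Hd).
  pose proof (Rabs_pos m).
  apply Rle_lt_trans with (Rabs (B - sum_n c n) * Rabs m).
  { rewrite <- Rabs_mult. apply Rle_abs. }
  apply Rle_lt_trans with (Rabs (B - sum_n c n) * (Rabs m + 1)).
  { apply Rmult_le_compat_l; [apply Rabs_pos|lra]. }
  apply Rlt_le_trans with (eps / (Rabs m + 1) * (Rabs m + 1)).
  - apply Rmult_lt_compat_r; lra.
  - right; field; lra.
Qed.

(** * Complex powers of a positive real *)

Lemma Cexp_plus (v w : C) : Cexp (v + w) = (Cexp v * Cexp w)%C.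
Proof.
  unfold Cexp. destruct v as [a b], w as [c d]; simpl.
  rewrite exp_plus, cos_plus, sin_plus.
  apply injective_projections; simpl; ring.
Qed.

Lemma RCpower_Re (x : R) (s : C) :
  Re (RCpower x s) = exp (Re s * ln x) * cos (Im s * ln x).
Proof.
  unfold RCpower, Cexp. destruct s as [a b]; simpl.
  replace (a * ln x - b * 0) with (a * ln x) by ring.
  replace (a * 0 + b * ln x) with (b * ln x) by ring. ring.
Qed.

Lemma RCpower_Im (x : R) (s : C) :
  Im (RCpower x s) = exp (Re s * ln x) * sin (Im s * ln x).
Proof.
  unfold RCpower, Cexp. destruct s as [a b]; simpl.
  replace (a * ln x - b * 0) with (a * ln x) by ring.
  replace (a * 0 + b * ln x) with (b * ln x) by ring. ring.
Qed.

Lemma Cmod_Cexp (w : C) : Cmod (Cexp w) = exp (Re w).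
Proof.
  unfold Cexp. rewrite Cmod_mult, Cmod_R, (Rabs_pos_eq (exp _)) by (left; apply exp_pos).
  unfold Cmod; simpl. 
  replace (cos (Im w) * (cos (Im w) * 1) + sin (Im w) * (sin (Im w) * 1)) with 1.
  - rewrite sqrt_1. ring.
  - pose proof (sin2_cos2 (Im w)). unfold Rsqr in *. lra.
Qed.

Lemma Cmod_RCpower (x : R) (s : C) : Cmod (RCpower x s) = Rpower x (Re s).
Proof.
  unfold RCpower, Rpower. rewrite Cmod_Cexp. f_equal. destruct s; simpl. ring.
Qed.

Lemma RCpower_plus (x : R) (s t : C) : RCpower x (s + t) = (RCpower x s * RCpower x t)%C.
Proof. unfold RCpower. rewrite <- Cexp_plus. f_equal. ring. Qed.

Lemma RCpower_mult (x y : R) (s : C) :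
  0 < x -> 0 < y -> RCpower (x * y) s = (RCpower x s * RCpower y s)%C.
Proof.
  intros Hx Hy. unfold RCpower. rewrite <- Cexp_plus, ln_mult, RtoC_plus by assumption.
  f_equal. ring.
Qed.

Lemma RCpower_RtoC (x r : R) : RCpower x r = Rpower x r.
Proof.
  apply injective_projections.
  - etransitivity; [exact (RCpower_Re x r)|]. simpl.
    rewrite Rmult_0_l, cos_0. unfold Rpower. ring.
  - etransitivity; [exact (RCpower_Im x r)|]. simpl.
    rewrite Rmult_0_l, sin_0. ring.
Qed.

Lemma RCpower_INR (x : R) (n : nat) : 0 < x -> RCpower x (INR n) = (x ^ n)%C.
Proof. intros Hx. rewrite RCpower_RtoC, Rpower_pow, RtoC_pow by exact Hx. reflexivity. Qed.

Lemma RCpower_0 (x : R) : RCpower x 0 = 1%C.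
Proof. rewrite RCpower_RtoC. unfold Rpower. now rewrite Rmult_0_l, exp_0. Qed.

Lemma RCpower_1 (x : R) : 0 < x -> RCpower x 1 = x.
Proof. intros Hx. now rewrite RCpower_RtoC, Rpower_1. Qed.

Lemma RCpower_neq_0 (x : R) (s : C) : RCpower x s <> 0%C.
Proof.
  intros H. apply (f_equal Cmod) in H. rewrite Cmod_RCpower, Cmod_0 in H.
  unfold Rpower in H. pose proof (exp_pos (Re s * ln x)). lra.
Qed.

Lemma RCpower_opp (x : R) (s : C) : RCpower x (- s) = (/ RCpower x s)%C.
Proof.
  assert (E : (RCpower x s * RCpower x (- s))%C = 1%C).
  { rewrite <- RCpower_plus. replace (s + - s)%C with (RtoC 0) by ring. apply RCpower_0. }
  rewrite <- (Cmult_1_r (/ RCpower x s)), <- E. field. apply RCpower_neq_0.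
Qed.

Lemma RCpower_inv (x : R) (s : C) : 0 < x -> RCpower (/ x) s = RCpower x (- s).
Proof. intros Hx. unfold RCpower. rewrite ln_Rinv by exact Hx. rewrite RtoC_opp. f_equal. ring. Qed.

Lemma RCpower_sqr (x : R) (s : C) : 0 < x -> RCpower (x ^ 2) s = RCpower x (2 * s).
Proof.
  intros Hx. replace (x ^ 2) with (x * x) by ring. rewrite RCpower_mult by exact Hx.
  rewrite <- RCpower_plus. f_equal. ring.
Qed.

Lemma continuous_exp_ln_mult (u v x : R) (k : R -> R) :
  0 < x -> continuous k (v * ln x) ->
  continuous (fun t => exp (u * ln t) * k (v * ln t)) x.
Proof.
  intros Hx Hk. assert (Hln : forall c, continuous (fun t => c * ln t) x).
  { intros c. apply (ex_derive_continuous (K := R_AbsRing) (V := R_NormedModule)).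
    auto_derive. exact Hx. }
  apply (continuous_mult (K := R_AbsRing)).
  - apply (continuous_comp (fun t => u * ln t) exp); [apply Hln|apply continuous_exp].
  - apply (continuous_comp (fun t => v * ln t) k); [apply Hln|exact Hk].
Qed.

Lemma continuous_RCpower (s : C) (x : R) :
  0 < x -> continuous (U := C_UniformSpace) (fun t => RCpower t s) x.
Proof.
  intros Hx. apply continuous_C.
  - apply continuous_ext with (fun t => exp (Re s * ln t) * cos (Im s * ln t)).
    { intros t; now rewrite RCpower_Re. }
    apply continuous_exp_ln_mult; [exact Hx|apply continuous_cos].
  - apply continuous_ext with (fun t => exp (Re s * ln t) * sin (Im s * ln t)).
    { intros t; now rewrite RCpower_Im. }
    apply continuous_exp_ln_mult; [exact Hx|apply continuous_sin].
Qed.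

Lemma continuous_RtoC (f : R -> R) (x : R) :
  continuous f x -> continuous (U := C_UniformSpace) (fun t => RtoC (f t)) x.
Proof. intros H. apply continuous_C; simpl; [exact H|apply continuous_const]. Qed.

(** * An explicit integrable majorant *)

(** The beta prime density with parameters [p] and 1.  It serves as majorant
    everywhere because it has the bounded antiderivative [(x / (1 + x))^p], so
    its improper integral is computed rather than estimated. *)
Definition beta_prime (p x : R) : R := p * Rpower x (p - 1) / Rpower (1 + x) (p + 1).

Lemma is_derive_beta_prime (p x : R) :
  0 < x -> is_derive (fun t => Rpower (t / (1 + t)) p) x (beta_prime p x).
Proof.
  intros Hx. unfold beta_prime, Rpower.
  assert (0 < x / (1 + x)) by (apply Rdiv_lt_0_compat; lra).
  auto_derive; [repeat split; lra|].
  change (x * / (1 + x)) with (x / (1 + x)). rewrite !ln_div by lra.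
  replace (p * (ln x - ln (1 + x))) with
    ((p - 1) * ln x + (ln x + (ln (1 + x) + - ((p + 1) * ln (1 + x))))) by ring.
  rewrite !exp_plus, exp_Ropp, !exp_ln by lra.
  field. repeat split; try lra. apply Rgt_not_eq, exp_pos.
Qed.

Lemma continuous_beta_prime (p x : R) : 0 < x -> continuous (beta_prime p) x.
Proof.
  intros Hx. apply (ex_derive_continuous (K := R_AbsRing) (V := R_NormedModule)).
  unfold beta_prime, Rpower. auto_derive. repeat split; try lra.
  apply Rgt_not_eq, exp_pos.
Qed.

Lemma is_RInt_gen_beta_prime (p : R) :
  0 < p -> is_RInt_gen (beta_prime p) (at_right 0) (Rbar_locally p_infty) 1.
Proof.
  intros Hp. set (H := fun t => Rpower (t / (1 + t)) p).
  assert (HD : forall x, 0 < x -> Derive H x = beta_prime p x).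
  { intros x Hx. apply is_derive_unique. now apply is_derive_beta_prime. }
  assert (Hend : ends_0_infty (fun ab => forall x,
    Rmin (fst ab) (snd ab) <= x <= Rmax (fst ab) (snd ab) -> 0 < x)).
  { generalize ends_0_infty_pos. apply filter_imp. intros [a b] [Ha Hb] x [Hx _].
    now apply Rmin_le_pos with a b. }
  refine (is_RInt_gen_ext (V := R_NormedModule) (Fa := at_right 0)
            (Fb := Rbar_locally p_infty) (Derive H) (beta_prime p) 1 _ _).
  { generalize Hend. apply filter_imp. intros ab Hab x Hx. apply HD, Hab. lra. }
  replace 1 with (1 - 0) by ring.
  refine (is_RInt_gen_Derive (Fa := at_right 0) (Fb := Rbar_locally p_infty) H 0 1 _ _ _ _).
  - generalize Hend. apply filter_imp. intros ab Hab x Hx.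
    exists (beta_prime p x). apply is_derive_beta_prime. now apply Hab.
  - generalize Hend. apply filter_imp. intros ab Hab x Hx. specialize (Hab x Hx).
    apply continuous_ext_loc with (beta_prime p); [|now apply continuous_beta_prime].
    generalize (open_gt 0 x Hab). apply filter_imp. intros y Hy. symmetry. now apply HD.
  - apply (filterlim_locally (F := at_right 0)). intros eps.
    exists (mkposreal (Rpower eps (/ p)) (exp_pos _)). intros t Ht H0.
    change (Rabs (t - 0) < Rpower eps (/ p)) in Ht. rewrite Rminus_0_r, Rabs_pos_eq in Ht by lra.
    change (Rabs (H t - 0) < eps). rewrite Rminus_0_r.
    rewrite Rabs_pos_eq by (left; apply exp_pos).
    assert (E : 0 < t / (1 + t) < Rpower eps (/ p)).
    { split; [apply Rdiv_lt_0_compat; lra|]. apply Rle_lt_trans with (2 := Ht).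
      apply Rmult_le_reg_r with (1 + t); [lra|]. field_simplify; [|lra]. nra. }
    apply (Rlt_Rpower_l _ _ p Hp) in E.
    rewrite Rpower_mult, Rinv_l, Rpower_1 in E by (try apply cond_pos; lra). exact E.
  - apply (filterlim_comp _ _ _ (fun t => t / (1 + t)) (fun u => Rpower u p) _ (locally 1)).
    + apply (filterlim_locally (F := Rbar_locally p_infty)). intros eps.
      pose proof (cond_pos eps) as He.
      exists (/ eps). intros t Ht.
      assert (0 < / eps) by now apply Rinv_0_lt_compat.
      change (Rabs (t / (1 + t) - 1) < eps).
      replace (t / (1 + t) - 1) with (- (/ (1 + t))) by (field; lra).
      rewrite Rabs_Ropp, Rabs_pos_eq by (left; apply Rinv_0_lt_compat; lra).
      rewrite <- (Rinv_inv eps). apply Rinv_lt_contravar; [|lra].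
      apply Rmult_lt_0_compat; lra.
    + assert (E : Rpower 1 p = 1) by (unfold Rpower; now rewrite ln_1, Rmult_0_r, exp_0).
      rewrite <- E at 2.
      apply (ex_derive_continuous (K := R_AbsRing) (V := R_NormedModule) (fun u => Rpower u p)).
      unfold Rpower. auto_derive. lra.
Qed.

(** [exp (- x) (1 + x)^(p + 1)] is bounded, since [ln y <= y - 1] applied to
    [y = (1 + x) / k] with [k = p + 1] gives
    [k ln (1 + x) <= k ln k + (1 + x) - k]. *)
Lemma exp_Rpower_le_beta_prime (p : R) :
  0 < p -> exists K, 0 < K /\ forall x, 0 < x -> exp (- x) * Rpower x (p - 1) <= K * beta_prime p x.
Proof.
  intros Hp. set (k := p + 1).
  (* The constant is the maximum of [exp (- x) (1 + x)^k], attained at [x = k - 1],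
     divided by [p]. *)
  exists (exp (k * ln k + 1 - k) / p). split.
  { apply Rdiv_lt_0_compat; [apply exp_pos|exact Hp]. }
  intros x Hx. unfold beta_prime.
  replace (exp (k * ln k + 1 - k) / p * (p * Rpower x (p - 1) / Rpower (1 + x) (p + 1)))
    with (exp (k * ln k + 1 - k) / Rpower (1 + x) (p + 1) * Rpower x (p - 1)).
  2:{ field. split; [apply Rgt_not_eq, exp_pos|lra]. }
  apply Rmult_le_compat_r; [left; apply exp_pos|].
  unfold Rpower, Rdiv. rewrite <- exp_Ropp, <- exp_plus.
  assert (Hk : 0 < k) by (unfold k; lra).
  assert (Hl : ln (1 + x) <= ln k + (1 + x) / k - 1).
  { pose proof (exp_ineq1_le (ln ((1 + x) / k))) as E.
    rewrite exp_ln in E by (apply Rdiv_lt_0_compat; lra).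
    rewrite ln_div in E by lra. lra. }
  fold k.
  assert (E : k * ln (1 + x) <= k * ln k + (1 + x) - k).
  { apply (Rmult_le_compat_l k) in Hl; [|lra].
    replace (k * (ln k + (1 + x) / k - 1)) with (k * ln k + (1 + x) - k) in Hl by (field; lra).
    exact Hl. }
  destruct (Rle_lt_or_eq_dec (- x) (k * ln k + 1 - k + - (k * ln (1 + x)))) as [L|L]; [lra| |].
  - left. now apply exp_increasing.
  - right. now rewrite L.
Qed.

(** * Euler's integral and the functional equation of Gamma *)

Lemma continuous_Gamma_integrand (s : C) (x : R) :
  0 < x -> continuous (U := C_UniformSpace) (fun t => (exp (- t) * RCpower t (s - 1))%C) x.
Proof.
  intros Hx. apply continuous_Cmult; [|now apply continuous_RCpower].
  apply continuous_RtoC.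
  apply (ex_derive_continuous (K := R_AbsRing) (V := R_NormedModule)). auto_derive. exact I.
Qed.

Lemma is_CInt_EulerGamma (s : C) :
  0 < Re s -> is_CInt_0_infty (fun t => (exp (- t) * RCpower t (s - 1))%C) (EulerGamma s).
Proof.
  intros Hs. apply CInt_0_infty_correct.
  destruct (exp_Rpower_le_beta_prime (Re s) Hs) as [K [HK Hle]].
  apply ex_CInt_0_infty_le with (fun x => K * beta_prime (Re s) x) (K * 1).
  - intros x Hx. now apply continuous_Gamma_integrand.
  - intros x Hx. apply (continuous_mult (K := R_AbsRing)); [apply continuous_const|].
    now apply continuous_beta_prime.
  - intros x Hx. rewrite Cmod_mult, Cmod_RCpower, Cmod_R.
    rewrite Rabs_pos_eq by (left; apply exp_pos).
    replace (Re (s - 1)) with (Re s - 1) by reflexivity. now apply Hle.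
  - exact (is_RInt_gen_scal (V := R_NormedModule) (beta_prime (Re s)) K 1 (is_RInt_gen_beta_prime _ Hs)).
Qed.

(** [t^s exp (- t)] is the boundary term of the integration by parts that
    proves the functional equation of Gamma; derivatives are taken by
    components. *)
Lemma is_derive_exp_RCpower (s : C) (x : R) : 0 < x ->
  is_derive (fun t => Re (exp (- t) * RCpower t s)%C) x
    (Re (s * (exp (- x) * RCpower x (s - 1)) - exp (- x) * RCpower x s)%C) /\
  is_derive (fun t => Im (exp (- t) * RCpower t s)%C) x
    (Im (s * (exp (- x) * RCpower x (s - 1)) - exp (- x) * RCpower x s)%C).
Proof.
  intros Hx.
  assert (E : RCpower x (s - 1) = (RCpower x s * / x)%C).
  { unfold Cminus. rewrite RCpower_plus, RCpower_opp, RCpower_1 by exact Hx. reflexivity. }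
  rewrite E. rewrite <- RtoC_inv by lra.
  assert (P : RCpower x s = (exp (Re s * ln x) * cos (Im s * ln x),
                             exp (Re s * ln x) * sin (Im s * ln x))).
  { apply injective_projections; [apply RCpower_Re|apply RCpower_Im]. }
  rewrite P.
  split.
  - apply is_derive_ext with (fun t => exp (- t) * (exp (Re s * ln t) * cos (Im s * ln t))).
    { intros t. rewrite <- RCpower_Re. unfold Re. simpl. ring. }
    destruct s as [a b]; simpl. auto_derive; [repeat split; lra|]. field. lra.
  - apply is_derive_ext with (fun t => exp (- t) * (exp (Re s * ln t) * sin (Im s * ln t))).
    { intros t. rewrite <- RCpower_Im. simpl. ring. }
    destruct s as [a b]; simpl. auto_derive; [repeat split; lra|]. field. lra.
Qed.

(** Near 0 the power is small; at infinity the function is below a multiple of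
    the beta prime density with parameter [r + 1], which decays like [1 / t^2]. *)
Lemma exp_Rpower_ends_small (r eps : R) : 0 < r -> 0 < eps ->
  ends_0_infty (fun ab => exp (- fst ab) * Rpower (fst ab) r < eps /\
                          exp (- snd ab) * Rpower (snd ab) r < eps).
Proof.
  intros Hr He.
  destruct (exp_Rpower_le_beta_prime (r + 1) ltac:(lra)) as [K [HK Hle]].
  unfold beta_prime in Hle. replace (r + 1 - 1) with r in Hle by ring.
  apply Filter_prod with (fun t => exp (- t) * Rpower t r < eps)
                         (fun t => exp (- t) * Rpower t r < eps); [| |auto].
  - exists (mkposreal (Rpower eps (/ r)) (exp_pos _)). intros t Ht H0.
    change (Rabs (t - 0) < Rpower eps (/ r)) in Ht. rewrite Rminus_0_r, Rabs_pos_eq in Ht by lra.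
    assert (E : Rpower t r < eps).
    { assert (E : 0 < t < Rpower eps (/ r)) by lra.
      apply (Rlt_Rpower_l _ _ r Hr) in E.
      rewrite Rpower_mult, Rinv_l, Rpower_1 in E by lra. exact E. }
    assert (exp (- t) < 1) by (rewrite <- exp_0; apply exp_increasing; lra).
    pose proof (exp_pos (- t)). pose proof (exp_pos (r * ln t)). unfold Rpower in *. nra.
  - exists (K * (r + 1) / eps). intros t Ht.
    assert (0 < K * (r + 1) / eps) by (apply Rdiv_lt_0_compat; nra).
    apply Rle_lt_trans with (1 := Hle t ltac:(lra)).
    assert (HR : Rpower t r < Rpower (1 + t) r) by (apply Rlt_Rpower_l; lra).
    assert (Hq : Rpower (1 + t) (r + 1 + 1) = Rpower (1 + t) r * (1 + t) ^ 2).
    { rewrite <- (Rpower_pow 2) by lra. rewrite <- Rpower_plus. f_equal. simpl. ring. }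
    rewrite Hq.
    assert (0 < Rpower t r) by apply exp_pos.
    apply Rlt_trans with (K * ((r + 1) * Rpower (1 + t) r / (Rpower (1 + t) r * (1 + t) ^ 2))).
    { apply Rmult_lt_compat_l; [exact HK|]. apply Rmult_lt_compat_r.
      - apply Rinv_0_lt_compat. apply Rmult_lt_0_compat; [lra|]. apply pow_lt; lra.
      - apply Rmult_lt_compat_l; lra. }
    replace (K * ((r + 1) * Rpower (1 + t) r / (Rpower (1 + t) r * (1 + t) ^ 2)))
      with (K * (r + 1) / (1 + t) ^ 2) by (field; lra).
    assert (Hlt : K * (r + 1) < t * eps).
    { apply (Rmult_lt_compat_r eps) in Ht; [|lra]. 
      replace (K * (r + 1) / eps * eps) with (K * (r + 1)) in Ht by (field; lra). exact Ht. }
    apply Rmult_lt_reg_r with ((1 + t) ^ 2); [apply pow_lt; lra|].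
    replace (K * (r + 1) / (1 + t) ^ 2 * (1 + t) ^ 2) with (K * (r + 1)) by (field; lra).
    nra.
Qed.

(** Integration by parts: the integral of the derivative of [t^s exp (- t)] is
    zero, because this function vanishes at both ends. *)
Lemma EulerGamma_succ (s : C) : 0 < Re s -> EulerGamma (s + 1) = (s * EulerGamma s)%C.
Proof.
  intros Hs.
  set (G := fun t => (exp (- t) * RCpower t s)%C).
  set (f := fun t => (s * (exp (- t) * RCpower t (s - 1)) - exp (- t) * RCpower t s)%C).
  assert (H1 : is_CInt_0_infty G (EulerGamma (s + 1))).
  { apply is_CInt_0_infty_ext with (fun t => (exp (- t) * RCpower t (s + 1 - 1))%C).
    { intros t _. unfold G. do 2 f_equal. ring. }
    refine (is_CInt_EulerGamma (s + 1) _). simpl. unfold Re in Hs. lra. }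
  assert (H2 := is_CInt_0_infty_Cmult s _ _ (is_CInt_EulerGamma s Hs)).
  assert (Hf : is_CInt_0_infty f (s * EulerGamma s - EulerGamma (s + 1))%C).
  { unfold f. replace (s * EulerGamma s - EulerGamma (s + 1))%C
      with (s * EulerGamma s + (- 1) * EulerGamma (s + 1))%C by ring.
    apply is_CInt_0_infty_ext with
      (fun t => s * (exp (- t) * RCpower t (s - 1)) + (- 1) * G t)%C.
    { intros x _. unfold G. ring. }
    apply is_CInt_0_infty_plus; [exact H2|]. now apply is_CInt_0_infty_Cmult. }
  assert (H0 : is_CInt_0_infty f 0%C).
  { assert (Cf : forall x, 0 < x -> continuous (U := C_UniformSpace) f x).
    { intros x Hx. unfold f. apply (continuous_minus (V := C_R_NormedModule)).
      - apply continuous_Cmult; [apply continuous_const|now apply continuous_Gamma_integrand].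
      - apply continuous_ext with (fun t => (exp (- t) * RCpower t (s + 1 - 1))%C).
        { intros t. do 2 f_equal. ring. }
        now apply continuous_Gamma_integrand. }
    assert (HG : forall t, Cmod (G t) = exp (- t) * Rpower t (Re s)).
    { intros t. unfold G. rewrite Cmod_mult, Cmod_RCpower, Cmod_R.
      now rewrite Rabs_pos_eq by (left; apply exp_pos). }
    apply is_CInt_0_infty_eps. intros eps He.
    generalize (filter_and _ _ ends_0_infty_pos (exp_Rpower_ends_small (Re s) (eps / 2) Hs ltac:(lra))).
    apply filter_imp. intros [a b] [[Ha Hb] [Ea Eb]]; simpl in *.
    assert (Hpos : forall x, Rmin a b <= x <= Rmax a b -> 0 < x).
    { intros x [Hx _]. now apply Rmin_le_pos with a b. }
    exists (G b - G a)%C. split.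
    - apply is_RInt_C.
      + apply (is_RInt_derive (V := R_CompleteNormedModule) (fun t => Re (G t)) (fun t => Re (f t))).
        * intros x Hx. exact (proj1 (is_derive_exp_RCpower s x (Hpos x Hx))).
        * intros x Hx. exact (continuous_Re f x (Cf x (Hpos x Hx))).
      + apply (is_RInt_derive (V := R_CompleteNormedModule) (fun t => Im (G t)) (fun t => Im (f t))).
        * intros x Hx. exact (proj2 (is_derive_exp_RCpower s x (Hpos x Hx))).
        * intros x Hx. exact (continuous_Im f x (Cf x (Hpos x Hx))).
    - replace (G b - G a - 0)%C with (G b + - G a)%C by ring.
      eapply Rle_lt_trans; [apply Cmod_triangle|]. rewrite Cmod_opp, !HG. lra. }
  apply is_CInt_0_infty_unique in Hf. apply is_CInt_0_infty_unique in H0.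
  rewrite H0 in Hf. 
  replace (EulerGamma (s + 1)) with (s * EulerGamma s - (s * EulerGamma s - EulerGamma (s + 1)))%C by ring.
  rewrite <- Hf. ring.
Qed.

(** For [Re s > 0] the shift in the continuation of Gamma is 0. *)
Lemma CGamma_EulerGamma (s : C) : 0 < Re s -> CGamma s = EulerGamma s.
Proof.
  intros Hs. unfold CGamma.
  assert (E : Z.to_nat (up (- Re s)) = O).
  { destruct (archimed (- Re s)) as [_ H].
    assert (H1 : (up (- Re s) < 1)%Z) by (apply lt_IZR; lra). lia. }
  rewrite E. simpl. replace (s + 0)%C with s by ring. field.
Qed.

Lemma CGamma_poch (s : C) (n : nat) :
  0 < Re s -> CGamma (s + INR n) = (CGamma s * poch s n)%C.
Proof.
  intros Hs. induction n as [|n IH].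
  - simpl. rewrite Cplus_0_r. ring.
  - assert (Hn : 0 < Re (s + INR n)).
    { pose proof (pos_INR n). simpl. unfold Re in Hs. lra. }
    assert (Hn' : 0 < Re (s + INR n + 1)) by (simpl in *; lra).
    rewrite S_INR, RtoC_plus, Cplus_assoc.
    rewrite CGamma_EulerGamma, EulerGamma_succ, <- CGamma_EulerGamma, IH by assumption.
    simpl. ring.
Qed.

(** * The Gaussian moments *)

Lemma RtoC_neq_0 (x : R) : x <> 0 -> RtoC x <> 0%C.
Proof. intros H E. apply H. now apply RtoC_inj. Qed.

(** The substitution [t = x^2 / (2 a)] in Euler's integral. *)
Lemma is_CInt_Gauss (a : R) (w : C) :
  0 < a -> 0 < Re w ->
  is_CInt_0_infty (fun x => (exp (- (x ^ 2 / (2 * a))) * RCpower x (2 * w - 1))%C)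
    (RCpower (2 * a) w / 2 * EulerGamma w)%C.
Proof.
  intros Ha Hw.
  set (G := fun t => (exp (- t) * RCpower t (w - 1))%C).
  apply is_CInt_0_infty_ext with
    (fun x => (RCpower (2 * a) w / 2) * (RtoC (x / a) * G (x ^ 2 / (2 * a))%R))%C.
  { intros x Hx. unfold G.
    change (x ^ 2 / (2 * a)) with (x ^ 2 * / (2 * a)).
    assert (Hinv : 0 < / (2 * a)) by (apply Rinv_0_lt_compat; lra).
    rewrite (RCpower_mult (x ^ 2) (/ (2 * a))) by (exact Hinv || now apply pow_lt).
    rewrite RCpower_sqr, RCpower_inv by lra.
    replace (- (w - 1))%C with (- w + 1)%C by ring.
    rewrite RCpower_plus, RCpower_opp, RCpower_1 by lra.
    replace (2 * (w - 1))%C with (2 * w - 1 + - (1))%C by ring.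
    rewrite RCpower_plus, RCpower_opp, RCpower_1 by lra.
    unfold Rdiv. rewrite !RtoC_mult, RtoC_inv by lra.
    field. repeat split; try (apply RCpower_neq_0); apply RtoC_neq_0; lra. }
  apply is_CInt_0_infty_Cmult.
  apply is_CInt_0_infty_eps. intros eps He.
  destruct (proj1 (is_CInt_0_infty_eps G _) (is_CInt_EulerGamma w Hw) eps He)
    as [P Q HP HQ HPQ].
  assert (Hsq : forall x, 0 < x -> 0 < x ^ 2 / (2 * a)).
  { intros x Hx. apply Rdiv_lt_0_compat; [now apply pow_lt|lra]. }
  assert (HP' : at_right 0 (fun x => 0 < x /\ P (x ^ 2 / (2 * a)))).
  { destruct HP as [d Hd]. pose proof (cond_pos d) as Hd0.
    assert (Hm : 0 < Rmin 1 (2 * a * d)) by (apply Rmin_glb_lt; nra).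
    exists (mkposreal _ Hm). intros x Hx H0. split; [exact H0|].
    change (Rabs (x - 0) < Rmin 1 (2 * a * d)) in Hx.
    rewrite Rminus_0_r, Rabs_pos_eq in Hx by lra.
    pose proof (Rmin_l 1 (2 * a * d)). pose proof (Rmin_r 1 (2 * a * d)).
    specialize (Hsq x H0).
    apply Hd; [|exact Hsq].
    change (Rabs (x ^ 2 / (2 * a) - 0) < d). rewrite Rminus_0_r, Rabs_pos_eq by lra.
    apply Rmult_lt_reg_r with (2 * a); [lra|].
    replace (x ^ 2 / (2 * a) * (2 * a)) with (x ^ 2) by (field; lra). nra. }
  assert (HQ' : Rbar_locally p_infty (fun x => 0 < x /\ Q (x ^ 2 / (2 * a)))).
  { destruct HQ as [M HM]. exists (Rmax 1 (2 * a * M)). intros x Hx.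
    pose proof (Rmax_l 1 (2 * a * M)). pose proof (Rmax_r 1 (2 * a * M)).
    split; [lra|]. apply HM.
    apply Rmult_lt_reg_r with (2 * a); [lra|].
    replace (x ^ 2 / (2 * a) * (2 * a)) with (x ^ 2) by (field; lra). nra. }
  apply Filter_prod with (1 := HP') (2 := HQ').
  intros u v [Hu Pu] [Hv Qv]; simpl.
  destruct (HPQ _ _ Pu Qv) as [z [Hz1 Hz2]]. cbn [fst snd] in Hz1. exists z. split; [|exact Hz2].
  assert (Hpos : forall x, Rmin u v <= x <= Rmax u v -> 0 < x).
  { intros x [Hx _]. now apply Rmin_le_pos with u v. }
  pose proof (is_RInt_comp (V := C_R_CompleteNormedModule) G (fun x => x ^ 2 / (2 * a))
                (fun x => x / a) u v) as Hc.
  rewrite <- (is_RInt_unique (V := C_R_CompleteNormedModule) _ _ _ _ Hz1).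
  refine (is_RInt_ext (V := C_R_NormedModule) _ _ _ _ _ _ (Hc _ _)).
  - intros x _. set (y := G (x ^ 2 / (2 * a))%R).
    change ((x / a * Re y, x / a * Im y) = (RtoC (x / a) * y)%C).
    apply injective_projections; simpl; unfold Re, Im; ring.
  - intros x Hx. apply continuous_Gamma_integrand, Hsq. now apply Hpos.
  - intros x Hx. split.
    + auto_derive; [lra|]. field. lra.
    + apply (ex_derive_continuous (K := R_AbsRing) (V := R_NormedModule)). auto_derive. lra.
Qed.

(** * The real part of the order *)

(** With [w] of modulus [r] and argument [th], the half-angle formula gives
    [(Re (sqrt w))^2 = r cos^2 (th / 2) = (r + Re w) / 2]. *)
Lemma Re_Csqrt (w : C) : 0 < Re w -> 0 < Re (Csqrt w) /\ Re w <= (Re (Csqrt w)) ^ 2.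
Proof.
  intros Hw. unfold Csqrt. destruct (Ceq_dec w 0) as [->|Hn]; [simpl in Hw; lra|].
  assert (Hm : 0 < Cmod w) by now apply Cmod_gt_0.
  assert (Hle : Re w <= Cmod w).
  { apply Rle_trans with (2 := re_le_Cmod w). apply Rle_abs. }
  set (th := Carg w).
  assert (Hq : 0 < Re w / Cmod w <= 1).
  { split; [now apply Rdiv_lt_0_compat|]. apply Rmult_le_reg_r with (Cmod w); [exact Hm|].
    replace (Re w / Cmod w * Cmod w) with (Re w) by (field; lra). lra. }
  assert (Hcos : cos th = Re w / Cmod w).
  { unfold th, Carg. destruct (Rle_dec 0 (Im w)); [|rewrite cos_neg]; apply cos_acos; lra. }
  assert (Hth : - PI <= th <= PI).
  { unfold th, Carg. pose proof (acos_bound (Re w / Cmod w)).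
    destruct (Rle_dec 0 (Im w)); lra. }
  assert (E : Re (Cexp (Clog w / 2)) = exp (ln (Cmod w) / 2) * cos (th / 2)).
  { assert (E : (Clog w / 2)%C = (ln (Cmod w) / 2, th / 2)).
    { unfold Clog. fold th. apply injective_projections; simpl; field. }
    rewrite E. unfold Cexp. simpl. ring. }
  rewrite E.
  assert (Hc2 : cos th = 2 * cos (th / 2) ^ 2 - 1).
  { replace th with (2 * (th / 2)) at 1 by field. rewrite cos_2a_cos. ring. }
  assert (Hc : 0 < cos (th / 2)).
  { assert (0 <= cos (th / 2)) by (apply cos_ge_0; lra). nra. }
  pose proof (exp_pos (ln (Cmod w) / 2)) as He.
  assert (He2 : exp (ln (Cmod w) / 2) ^ 2 = Cmod w).
  { simpl. rewrite Rmult_1_r, <- exp_plus.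
    replace (ln (Cmod w) / 2 + ln (Cmod w) / 2) with (ln (Cmod w)) by field. now apply exp_ln. }
  split; [nra|].
  rewrite Rpow_mult_distr, He2.
  assert (Hr : Re w = Cmod w * cos th) by (rewrite Hcos; field; lra).
  rewrite Hr. nra.
Qed.

(** [Re (mu^2) = 2 Re z + nu^2] exceeds [(nu + 2)^2], since
    [(nu + 2)^2 - nu^2 = 4 (nu + 1)]. *)
Lemma Re_mu (nu : R) (z : C) :
  Rmax 0 (2 * (nu + 1)) < Re z -> 0 < Re (mu nu z) /\ - (nu + 2) < Re (mu nu z).
Proof.
  intros Hz. pose proof (Rmax_l 0 (2 * (nu + 1))). pose proof (Rmax_r 0 (2 * (nu + 1))).
  assert (E : Re (2 * z + nu ^ 2)%C = 2 * Re z + nu ^ 2).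
  { rewrite <- RtoC_pow. destruct z; simpl. ring. }
  destruct (Re_Csqrt (2 * z + nu ^ 2)%C) as [H1 H2]; rewrite E in *.
  { nra. }
  fold (mu nu z) in *. split; [exact H1|].
  destruct (Rle_dec 0 (nu + 2)); nra.
Qed.

(** * Bounds for the terms of the expansion *)

(** Each factor [s + 1 + k] has real part at least [k + 1]. *)
Lemma Cmod_poch_ge (s : C) (n : nat) : 0 < Re s -> INR (fact n) <= Cmod (poch (s + 1) n).
Proof.
  intros Hs. induction n as [|n IH].
  - simpl. rewrite Cmod_1. lra.
  - simpl poch. rewrite Cmod_mult. rewrite fact_simpl, mult_INR, Rmult_comm.
    apply Rmult_le_compat; [apply pos_INR|apply pos_INR|exact IH|].
    apply Rle_trans with (Re (s + 1 + INR n)).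
    + rewrite S_INR. simpl. unfold Re in Hs. lra.
    + apply Rle_trans with (2 := re_le_Cmod _). apply Rle_abs.
Qed.

Lemma pow_div_fact_le_exp (t : R) (n : nat) : 0 <= t -> t ^ n / INR (fact n) <= exp t.
Proof.
  intros Ht.
  assert (Hn : forall k, 0 <= / INR (fact k) * t ^ k).
  { intros k. apply Rmult_le_pos; [|now apply pow_le].
    left. apply Rinv_0_lt_compat, INR_fact_lt_0. }
  pose proof (sum_incr _ n _ (proj2_sig (exist_exp t)) Hn) as S.
  apply Rle_trans with (2 := S).
  unfold Rdiv. rewrite Rmult_comm. destruct n as [|n]; [apply Rle_refl|].
  rewrite tech5. pose proof (cond_pos_sum _ n Hn). lra.
Qed.

(** Half of the Gaussian weight absorbs the power of [x]: with
    [t = x^2 / (4 a)] the expression is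
    [exp (- t) x^(p - 1) (1 / a)^n] times [exp (- t) t^n / n! <= 1].  The other
    half is at most [exp (a - x)] because [(x - 2 a)^2 >= 0]. *)
Lemma Gauss_pow_le_beta_prime (a p : R) : 0 < a -> 0 < p ->
  exists A, 0 < A /\ forall n x, 0 < x ->
    exp (- (x ^ 2 / (2 * a))) * Rpower x (p - 1) * ((x / (2 * a)) ^ 2) ^ n / INR (fact n)
    <= A * (/ a) ^ n * beta_prime p x.
Proof.
  intros Ha Hp. destruct (exp_Rpower_le_beta_prime p Hp) as [K [HK Hle]].
  exists (exp a * K). split; [apply Rmult_lt_0_compat; [apply exp_pos|exact HK]|].
  intros n x Hx.
  set (t := x ^ 2 / (4 * a)).
  assert (Ht : 0 <= t) by (apply Rle_mult_inv_pos; [apply pow2_ge_0|lra]).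
  replace ((x / (2 * a)) ^ 2) with (t * / a) by (unfold t; field; lra).
  rewrite Rpow_mult_distr.
  assert (E : exp (- (x ^ 2 / (2 * a))) = exp (- t) * exp (- t)).
  { rewrite <- exp_plus. f_equal. unfold t. field. lra. }
  rewrite E.
  replace (exp (- t) * exp (- t) * Rpower x (p - 1) * (t ^ n * (/ a) ^ n) / INR (fact n))
    with ((exp (- t) * Rpower x (p - 1)) * (/ a) ^ n * (exp (- t) * (t ^ n / INR (fact n))))
    by (field; apply INR_fact_neq_0).
  assert (H1 : exp (- t) * (t ^ n / INR (fact n)) <= 1).
  { rewrite <- exp_0. replace 0 with (- t + t) by ring. rewrite exp_plus.
    apply Rmult_le_compat_l; [left; apply exp_pos|]. now apply pow_div_fact_le_exp. }
  assert (H2 : exp (- t) <= exp a * exp (- x)).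
  { rewrite <- exp_plus.
    assert (- t <= a + - x).
    { assert (0 <= (x - 2 * a) ^ 2 / (4 * a)) by (apply Rle_mult_inv_pos; [apply pow2_ge_0|lra]).
      replace ((x - 2 * a) ^ 2 / (4 * a)) with (t - x + a) in H by (unfold t; field; lra). lra. }
    destruct H as [H|H]; [left; now apply exp_increasing|right; now rewrite H]. }
  assert (Hpow : 0 <= (/ a) ^ n) by (apply pow_le; left; now apply Rinv_0_lt_compat).
  pose proof (exp_pos ((p - 1) * ln x)) as HR. fold (Rpower x (p - 1)) in HR.
  pose proof (exp_pos (- t)). pose proof (exp_pos a). specialize (Hle x Hx).
  apply Rle_trans with ((exp (- t) * Rpower x (p - 1)) * (/ a) ^ n * 1).
  { apply Rmult_le_compat_l; [|exact H1]. repeat apply Rmult_le_pos; lra. }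
  replace (exp a * K * (/ a) ^ n * beta_prime p x) with (exp a * (K * beta_prime p x) * (/ a) ^ n * 1) by ring.
  apply Rmult_le_compat_r; [lra|]. apply Rmult_le_compat_r; [exact Hpow|].
  apply Rle_trans with (exp a * exp (- x) * Rpower x (p - 1)).
  - apply Rmult_le_compat_r; lra.
  - rewrite Rmult_assoc. apply Rmult_le_compat_l; lra.
Qed.

(** Unconditional, because [/ 0 = 0]. *)
Lemma Cinv_mult (x y : C) : (/ (x * y))%C = (/ x * / y)%C.
Proof.
  assert (C0inv : (/ 0)%C = RtoC 0).
  { apply injective_projections; simpl; unfold Rdiv; ring. }
  destruct (Ceq_dec x 0) as [->|Hx]; [rewrite Cmult_0_l, C0inv; ring|].
  destruct (Ceq_dec y 0) as [->|Hy]; [rewrite Cmult_0_r, C0inv; ring|].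
  field. now split.
Qed.

Lemma poch_neq_0 (s : C) (n : nat) : 0 < Re s -> poch (s + 1) n <> 0%C.
Proof.
  intros Hs E. pose proof (Cmod_poch_ge s n Hs) as H. rewrite E, Cmod_0 in H.
  pose proof (INR_fact_lt_0 n). lra.
Qed.

Lemma RCpower_double (x : R) (n : nat) :
  0 < x -> RCpower x (2 * INR n) = (x ^ n * x ^ n)%C.
Proof.
  intros Hx. replace (2 * INR n)%C with (INR n + INR n)%C by ring.
  now rewrite RCpower_plus, RCpower_INR.
Qed.

Definition Bessel_term (m : C) (n : nat) (xi : R) : C :=
  (RCpower (xi / 2) (m + 2 * INR n) / (INR (fact n) * CGamma (m + 1 + INR n)))%C.

Definition Dnu_term (nu a : R) (m : C) (n : nat) (x : R) : C :=
  (RtoC (exp (- (x ^ 2 / (2 * a))) * Rpower x (nu + 3)) * Bessel_term m n (x / a))%C.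

Lemma Re_pos_succ (s : C) : 0 < Re s -> 0 < Re (s + 1).
Proof. simpl. unfold Re. lra. Qed.

(** Collects the powers of [x], so that the integral of each term becomes an
    instance of [is_CInt_Gauss]. *)
Lemma Dnu_term_eq (nu a : R) (m : C) (n : nat) (x : R) :
  0 < a -> 0 < Re m -> 0 < x ->
  let alpha := ((nu + 4 + m) / 2)%C in
  Dnu_term nu a m n x =
    ((/ RCpower (2 * a) m * / ((2 * a) ^ n * (2 * a) ^ n)
      * / (INR (fact n) * (CGamma (m + 1) * poch (m + 1) n)))
     * (exp (- (x ^ 2 / (2 * a))) * RCpower x (2 * (alpha + INR n) - 1)))%C.
Proof.
  intros Ha Hmu Hx alpha. unfold Dnu_term, Bessel_term.
  rewrite CGamma_poch by now apply Re_pos_succ.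
  rewrite RtoC_mult, <- (RCpower_RtoC x).
  replace (x / a / 2) with (x * / (2 * a)) by (field; lra).
  assert (H2a : 0 < 2 * a) by lra.
  rewrite RCpower_mult by (exact Hx || now apply Rinv_0_lt_compat).
  rewrite RCpower_inv, RCpower_opp by exact H2a.
  rewrite (RCpower_plus (2 * a) m), RCpower_double, Cinv_mult by exact H2a.
  replace (2 * (alpha + INR n) - 1)%C with (RtoC (nu + 3) + (m + 2 * INR n))%C.
  2:{ unfold alpha. rewrite RtoC_plus. field. }
  rewrite (RCpower_plus x (RtoC (nu + 3))). rewrite RtoC_mult. unfold Cdiv. ring.
Qed.

(** One factorial of the bound is the one in Bessel's series; the other comes
    from the Pochhammer symbol [poch (m + 1) n]. *)
Lemma Dnu_term_le (nu a : R) (m : C) :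
  0 < a -> 0 < Re m -> - (nu + 2) < Re m ->
  exists B, forall n x, 0 < x ->
    Cmod (Dnu_term nu a m n x) <= B * (/ INR (fact n) * (/ a) ^ n) * beta_prime (nu + 4 + Re m) x.
Proof.
  intros Ha Hmu Hnu.
  destruct (Gauss_pow_le_beta_prime a (nu + 4 + Re m) Ha ltac:(lra)) as [A [HA Hle]].
  exists (A * Rpower (/ (2 * a)) (Re m) * Cmod (/ CGamma (m + 1))).
  intros n x Hx. unfold Dnu_term, Bessel_term.
  rewrite CGamma_poch by now apply Re_pos_succ.
  unfold Cdiv. rewrite !Cinv_mult, !Cmod_mult.
  rewrite (Cmod_inv (INR (fact n))), (Cmod_inv (poch _ _))
    by (apply poch_neq_0, Hmu || apply RtoC_neq_0, INR_fact_neq_0).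
  rewrite !Cmod_R, Cmod_RCpower.
  pose proof (INR_fact_lt_0 n) as Hfact.
  rewrite (Rabs_pos_eq (INR _)) by lra.
  rewrite (Rabs_pos_eq (_ * _)) by (apply Rmult_le_pos; left; apply exp_pos).
  assert (Hinv : 0 < / (2 * a)) by (apply Rinv_0_lt_compat; lra).
  assert (E : Rpower (x / a / 2) (Re (m + 2 * INR n)) =
    Rpower x (Re m) * Rpower (/ (2 * a)) (Re m) * ((x / (2 * a)) ^ 2) ^ n).
  { replace (x / a / 2) with (x * / (2 * a)) by (field; lra).
    replace (Re (m + 2 * INR n)) with (Re m + INR (2 * n)).
    2:{ rewrite mult_INR. destruct m; simpl. ring. }
    assert (0 < x * / (2 * a)) by (apply Rmult_lt_0_compat; assumption).
    rewrite Rpower_plus, Rpower_pow, <- Rpower_mult_distr, pow_mult by assumption.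
    reflexivity. }
  rewrite E.
  specialize (Hle n x Hx).
  replace (nu + 4 + Re m - 1) with (nu + 3 + Re m) in Hle by ring.
  rewrite Rpower_plus in Hle.
  pose proof (Cmod_poch_ge m n Hmu) as Hpoch.
  assert (Hip : / Cmod (poch (m + 1) n) <= / INR (fact n)) by now apply Rinv_le_contravar.
  set (E0 := exp (- (x ^ 2 / (2 * a)))) in *.
  set (D := beta_prime (nu + 4 + Re m) x) in *.
  set (X := ((x / (2 * a)) ^ 2) ^ n) in *.
  set (Y := / INR (fact n)) in *.
  set (G := Cmod (/ CGamma (m + 1))).
  set (T := Rpower (/ (2 * a)) (Re m)).
  assert (HG : 0 <= G) by apply Cmod_ge_0.
  assert (HT : 0 < T) by apply exp_pos.
  assert (HE0 : 0 < E0) by apply exp_pos.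
  assert (HR1 : 0 < Rpower x (nu + 3)) by apply exp_pos.
  assert (HR2 : 0 < Rpower x (Re m)) by apply exp_pos.
  assert (HX : 0 <= X) by (apply pow_le, pow2_ge_0).
  assert (HY : 0 < Y) by now apply Rinv_0_lt_compat.
  set (P := / Cmod (poch (m + 1) n)) in *.
  apply Rle_trans with ((E0 * (Rpower x (nu + 3) * Rpower x (Re m)) * X * Y) * (T * G) * Y).
  - replace (E0 * Rpower x (nu + 3) * (Rpower x (Re m) * T * X * (Y * (G * P))))
      with (E0 * (Rpower x (nu + 3) * Rpower x (Re m)) * X * Y * (T * G) * P) by ring.
    apply Rmult_le_compat_l; [|exact Hip].
    repeat apply Rmult_le_pos; lra.
  - replace (A * T * G * (Y * (/ a) ^ n) * D) with (A * (/ a) ^ n * D * (T * G) * Y) by ring.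
    apply Rmult_le_compat_r; [lra|]. apply Rmult_le_compat_r; [apply Rmult_le_pos; lra|].
    exact Hle.
Qed.

Lemma is_series_exp (t B : R) :
  is_series (fun n => B * (/ INR (fact n) * t ^ n)) (B * exp t).
Proof.
  apply (is_series_scal (V := R_NormedModule) B).
  apply is_series_Reals. exact (proj2_sig (exist_exp t)).
Qed.

Lemma continuous_Dnu_term (nu a : R) (m : C) (n : nat) (x : R) :
  0 < a -> 0 < x -> continuous (U := C_UniformSpace) (Dnu_term nu a m n) x.
Proof.
  intros Ha Hx. unfold Dnu_term, Bessel_term, Cdiv.
  apply continuous_Cmult.
  - apply continuous_RtoC. apply (ex_derive_continuous (K := R_AbsRing) (V := R_NormedModule)).
    unfold Rpower. auto_derive. repeat split; lra.
  - apply continuous_Cmult; [|apply continuous_const].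
    apply (continuous_comp (fun t => t / a / 2) (fun t => RCpower t (m + 2 * INR n))).
    + apply (ex_derive_continuous (K := R_AbsRing) (V := R_NormedModule)). auto_derive. lra.
    + apply continuous_RCpower. repeat apply Rdiv_lt_0_compat; lra.
Qed.

(** * The closed form *)

Theorem mainTheorem2 :
  forall (nu a : R) (z : C),
    0 < a ->
    Rmax 0 (2 * (nu + 1)) < Re z ->
    ex_CInt_0_infty (Dnu_integrand nu a z) /\
    Dnu nu a z =
      (CGamma ((nu + 4 + mu nu z) / 2) / CGamma (mu nu z + 1)
       * KummerPhi ((nu + 4 + mu nu z) / 2) (mu nu z + 1) (1 / (2 * a))
       * (RCpower (2 * a) ((nu + 2 - mu nu z) / 2) / exp (1 / (2 * a))))%C.
Proof.
  intros nu a z Ha Hz. destruct (Re_mu nu z Hz) as [Hm Hnu].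
  unfold Dnu. set (m := mu nu z) in *.
  set (alpha := ((nu + 4 + m) / 2)%C).
  assert (Halpha : 0 < Re alpha).
  { assert (E : Re alpha = (nu + 4 + Re m) / 2).
    { unfold alpha. destruct m; simpl. field. }
    rewrite E. lra. }
  assert (H2a : 0 < 2 * a) by lra.
  destruct (Dnu_term_le nu a m Ha Hm Hnu) as [B HB].
  assert (HF : forall x, 0 < x ->
    is_Cseries (fun n => Dnu_term nu a m n x) (Dnu_integrand nu a z x)).
  { intros x Hx.
    assert (HS : is_Cseries (fun n => Dnu_term nu a m n x)
                   (CSeries (fun n => Dnu_term nu a m n x))).
    { apply ex_Cseries_le with (fun n => B * (/ INR (fact n) * (/ a) ^ n) * beta_prime (nu + 4 + Re m) x)
        (B * exp (/ a) * beta_prime (nu + 4 + Re m) x).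
      - intros n. now apply HB.
      - apply is_series_scal_r. apply is_series_exp. }
    pose proof (CSeries_factor _ _ _ HS) as E. rewrite E in HS.
    unfold Dnu_integrand. rewrite <- RtoC_mult. exact HS. }
  set (c := ((/ 2) * / RCpower (2 * a) m * RCpower (2 * a) alpha
             * (CGamma alpha / CGamma (m + 1)))%C).
  destruct (CInt_0_infty_Cseries (Dnu_term nu a m)
    (fun n => c * (poch alpha n / poch (m + 1) n * ((1 / (2 * a)) ^ n / INR (fact n))))%C
    (Dnu_integrand nu a z) (beta_prime (nu + 4 + Re m))
    (fun n => B * (/ INR (fact n) * (/ a) ^ n)) (B * exp (/ a)) 1) as [Hex Hser].
  - intros n x Hx. now apply continuous_Dnu_term.
  - intros x Hx. now apply continuous_beta_prime.
  - exact HB.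
  - apply is_series_exp.
  - apply is_RInt_gen_beta_prime. lra.
  - exact HF.
  - intros n.
    assert (Hn : 0 < Re (alpha + INR n)).
    { pose proof (pos_INR n). change (0 < Re alpha + INR n). lra. }
    assert (H2a' : RtoC (2 * a) <> 0%C) by (apply RtoC_neq_0; lra).
    replace (1 / (2 * a))%C with (/ RtoC (2 * a))%C.
    2:{ rewrite RtoC_mult. unfold Cdiv. now rewrite Cmult_1_l. }
    rewrite Cpow_inv by exact H2a'.
    apply is_CInt_0_infty_ext with (1 := fun x Hx => eq_sym (Dnu_term_eq nu a m n x Ha Hm Hx)).
    pose proof (is_CInt_0_infty_Cmult
      (/ RCpower (2 * a) m * / ((2 * a) ^ n * (2 * a) ^ n)
       * / (INR (fact n) * (CGamma (m + 1) * poch (m + 1) n)))%C _ _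
      (is_CInt_Gauss a (alpha + INR n) Ha Hn)) as HI.
    fold alpha.
    match type of HI with is_CInt_0_infty _ ?l => match goal with |- is_CInt_0_infty _ ?l' =>
      replace l' with l; [exact HI|] end end.
    rewrite <- CGamma_EulerGamma, CGamma_poch by assumption.
    rewrite (RCpower_plus (2 * a) alpha), RCpower_INR by exact H2a.
    rewrite <- RtoC_mult. unfold c, Cdiv. rewrite !Cinv_mult.
    pose proof (Cpow_nz _ n H2a') as Hnz.
    set (X := (RtoC (2 * a) ^ n)%C) in *.
    (* The left side has [/ X * / X] from the Bessel term and [X] from the Gaussian
       moment, where the right side has [/ X]. *)
    match goal with |- _ = ?r => transitivity (r * (/ X * X))%C; [ring|] end.
    rewrite (Cinv_l X) by exact Hnz. ring.
  - split; [exact Hex|].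
    apply CSeries_factor in Hser. rewrite Hser. fold (KummerPhi alpha (m + 1) (1 / (2 * a))).
    assert (E : RCpower (2 * a) ((nu + 2 - m) / 2) =
      (RCpower (2 * a) alpha * / RCpower (2 * a) m * / (2 * a))%C).
    { replace ((nu + 2 - m) / 2)%C with (alpha + (- m + - (1)))%C.
      - rewrite !RCpower_plus, !RCpower_opp, RCpower_1, RtoC_mult by exact H2a. ring.
      - unfold alpha. field. }
    rewrite E, exp_Ropp, RtoC_inv by (apply Rgt_not_eq, exp_pos).
    unfold c, Cdiv. rewrite !Cinv_mult. ring.
Qed.
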